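(* Let $m \geq 1$ and $n \geq 1$ be distinct integers, let $R$ be a semiprime ring which is $mn(m+n)|n-m|$-torsion free, and let $F : R \to R$ be a generalized $(m;n)$-Jordan derivation. Then $F$ is a derivation (i.e. $F(xy) = F(x)y + xF(y)$ for all $x,y\in R$) and $F(R) \subseteq Z(R)$.
   Context: All rings are associative. $Z(R)$ denotes the center of $R$. A ring $R$ is semiprime if $aRa = 0$ implies $a = 0$; it is $k$-torsion free if $ka = 0$ implies $a = 0$. For fixed integers $m,n\geq 0$ with $m+n \neq 0$, an additive map $D : R \to R$ is an $(m;n)$-Jordan derivation if $(m+n)D(x^2) = 2mD(x)x + 2nxD(x)$ for all $x \in R$. An additive map $F : R \to R$ is a generalized $(m;n)$-Jordan derivation if there exists an $(m;n)$-Jordan derivation $D : R \to R$ such that $(m+n)F(x^2) = 2mF(x)x + 2nxD(x)$ for all $x \in R$. *)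

(* Defs.v *)
(* Rings are associative but not necessarily unital:
   the carrier is an additive group (zmodType) with an explicit
   multiplication satisfying associativity and both distributive laws. *)
From HB Require Import structures.
From mathcomp Require Import all_boot all_order all_algebra.
Set Implicit Arguments. Unset Strict Implicit. Unset Printing Implicit Defensive.
Import GRing.Theory.
Local Open Scope ring_scope.

Definition assoc_ring (R : zmodType) (mul : R -> R -> R) : Prop :=
  [/\ forall x y z, mul x (mul y z) = mul (mul x y) z,
      forall x y z, mul (x + y) z = mul x z + mul y z &
      forall x y z, mul x (y + z) = mul x y + mul x z].

Definition in_center (R : zmodType) (mul : R -> R -> R) (z : R) : Prop :=
  forall r, mul z r = mul r z.

Definition semiprime (R : zmodType) (mul : R -> R -> R) : Prop :=
  forall a, (forall r, mul (mul a r) a = 0) -> a = 0.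

Definition torsion_free (R : zmodType) (k : nat) : Prop :=
  forall a : R, a *+ k = 0 -> a = 0.

Definition additive_map (R : zmodType) (f : R -> R) : Prop :=
  forall x y, f (x + y) = f x + f y.

Definition mn_jordan_derivation (R : zmodType) (mul : R -> R -> R)
    (m n : nat) (D : R -> R) : Prop :=
  additive_map D /\
  forall x, D (mul x x) *+ (m + n) =
            mul (D x) x *+ (2 * m) + mul x (D x) *+ (2 * n).

Definition gen_mn_jordan_derivation (R : zmodType) (mul : R -> R -> R)
    (m n : nat) (F : R -> R) : Prop :=
  additive_map F /\
  exists D : R -> R, mn_jordan_derivation mul m n D /\
    forall x, F (mul x x) *+ (m + n) =
              mul (F x) x *+ (2 * m) + mul x (D x) *+ (2 * n).

Definition derivation (R : zmodType) (mul : R -> R -> R) (F : R -> R) : Prop :=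
  forall x y, F (mul x y) = mul (F x) y + mul x (F y).

(* Main.v *)
(** Write d = D x, and let c be the commutation y |-> [y, x]. Expanding D on both
    sides of the Jordan identity (x^2 o y) o x = x^2 o (y o x) leaves
      (m+n) (m d c^2(y) - n c^2(y) d) + 2mn c([[d, x], y]) = 0   for all y.
    Replacing y by products and using semiprimeness gives first
    [[d, x], x] = 0, then, after linearization in x, [d, x] = 0. So D is a
    commuting Jordan derivation; the identity above now gives d [y, x] = 0,
    whence D is central and is a derivation. Finally G = F - D satisfies
    (m+n) G(x^2) = 2m G(x) x, and the Jordan identity for G yields
    G(x) x^3 = 0, G(x) x^2 = 0, G(x) x = 0 and G = 0 in turn.

    Each consequence is a linear combination, with scalars in Z[m, n], of
    two-sided multiples of earlier identities; the combinations are checked by a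
    reflective normalization of noncommutative polynomials. *)
Require Import Defs.
From HB Require Import structures.
From mathcomp Require Import all_boot all_order all_algebra.
From mathcomp Require Import zify.
Set Implicit Arguments. Unset Strict Implicit. Unset Printing Implicit Defensive.
Import GRing.Theory.
Local Open Scope ring_scope.

(** * Noncommutative polynomial identities *)

Inductive sexp :=
  SVar of nat | SConst of int | SAdd of sexp & sexp | SOpp of sexp
| SMul of sexp & sexp.

Inductive rexp :=
  RVar of nat | RZero | RAdd of rexp & rexp | ROpp of rexp
| RMul of rexp & rexp | RScale of rexp & sexp.

(* A monomial is a coefficient, a commutative word of scalar variables and a
   nonempty noncommutative word (first letter, other letters). *)
Definition smono := (int * seq nat)%type.
Definition rmono := (int * (seq nat * (nat * seq nat)))%type.

Fixpoint snorm (k : sexp) : seq smono :=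
  match k with
  | SVar i => [:: (Posz 1, [:: i])]
  | SConst c => [:: (c, [::])]
  | SAdd a b => snorm a ++ snorm b
  | SOpp a => [seq (- p.1, p.2) | p <- snorm a]
  | SMul a b => [seq (p.1 * q.1, p.2 ++ q.2) | p <- snorm a, q <- snorm b]
  end.

Definition rmono_mul (p q : rmono) : rmono :=
  (p.1 * q.1, (p.2.1 ++ q.2.1, (p.2.2.1, p.2.2.2 ++ q.2.2.1 :: q.2.2.2))).

Definition rmono_scale (p : rmono) (k : smono) : rmono :=
  (p.1 * k.1, (p.2.1 ++ k.2, p.2.2)).

Fixpoint rnorm (t : rexp) : seq rmono :=
  match t with
  | RVar i => [:: (Posz 1, ([::], (i, [::])))]
  | RZero => [::]
  | RAdd a b => rnorm a ++ rnorm b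
  | ROpp a => [seq (- p.1, p.2) | p <- rnorm a]
  | RMul a b => [seq rmono_mul p q | p <- rnorm a, q <- rnorm b]
  | RScale a k => [seq rmono_scale p q | p <- rnorm a, q <- snorm k]
  end.

Fixpoint rmono_insert (p : rmono) (l : seq rmono) : seq rmono :=
  if l is q :: l' then
    if p.2 == q.2 then (p.1 + q.1, q.2) :: l' else q :: rmono_insert p l'
  else [:: p].

(** Only the scalar word is sorted: scalars commute, ring letters do not. *)
Definition rmono_sort (p : rmono) : rmono :=
  (p.1, (sort leq p.2.1, p.2.2)).

Definition rcollect (l : seq rmono) : seq rmono :=
  foldr (fun p => rmono_insert (rmono_sort p)) [::] l.

Definition rnull (t : rexp) : bool :=
  all (fun p : rmono => p.1 == 0) (rcollect (rnorm t)).

(** * Soundness of the polynomial normal form *)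

Section Soundness.
Variables (R : zmodType) (mul : R -> R -> R).
Hypothesis Hring : assoc_ring mul.
Variables (env : seq R) (senv : seq int).

Let mulA x y z : mul x (mul y z) = mul (mul x y) z.
Proof. by case: Hring. Qed.

Let mulDl x y z : mul (x + y) z = mul x z + mul y z.
Proof. by case: Hring. Qed.

Let mulDr x y z : mul x (y + z) = mul x y + mul x z.
Proof. by case: Hring. Qed.

Lemma mul0x x : mul 0 x = 0.
Proof. by apply: (addrI (mul 0 x)); rewrite -mulDl !addr0. Qed.

Lemma mulx0 x : mul x 0 = 0.
Proof. by apply: (addrI (mul x 0)); rewrite -mulDr !addr0. Qed.

Lemma mulNx x y : mul (- x) y = - mul x y.
Proof. by apply/eqP; rewrite -addr_eq0 -mulDl addNr mul0x. Qed.

Lemma mulxN x y : mul x (- y) = - mul x y.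
Proof. by apply/eqP; rewrite -addr_eq0 -mulDr addNr mulx0. Qed.

Lemma mulzx x y (k : int) : mul (x *~ k) y = mul x y *~ k.
Proof.
have H n : mul (x *+ n) y = mul x y *+ n.
  by elim: n => [|n IH]; rewrite ?mulr0n ?mul0x // !mulrS mulDl IH.
by case: k => n; rewrite ?NegzE ?mulrNz ?mulNx -!pmulrn H.
Qed.

Lemma mulxz x y (k : int) : mul x (y *~ k) = mul x y *~ k.
Proof.
have H n : mul x (y *+ n) = mul x y *+ n.
  by elim: n => [|n IH]; rewrite ?mulr0n ?mulx0 // !mulrS mulDr IH.
by case: k => n; rewrite ?NegzE ?mulrNz ?mulxN -!pmulrn H.
Qed.

Fixpoint seval (k : sexp) : int :=
  match k with
  | SVar i => senv`_i
  | SConst c => c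
  | SAdd a b => seval a + seval b
  | SOpp a => - seval a
  | SMul a b => seval a * seval b
  end.

Fixpoint reval (t : rexp) : R :=
  match t with
  | RVar i => env`_i
  | RZero => 0
  | RAdd a b => reval a + reval b
  | ROpp a => - reval a
  | RMul a b => mul (reval a) (reval b)
  | RScale a k => reval a *~ seval k
  end.

Fixpoint word_eval (i : nat) (w : seq nat) : R :=
  if w is j :: w' then mul env`_i (word_eval j w') else env`_i.

Definition smono_eval (p : smono) : int := p.1 * \prod_(i <- p.2) senv`_i.

Definition rmono_eval (p : rmono) : R :=
  word_eval p.2.2.1 p.2.2.2 *~ smono_eval (p.1, p.2.1).

Lemma word_eval_cat i w j v :
  word_eval i (w ++ j :: v) = mul (word_eval i w) (word_eval j v).
Proof. by elim: w i => //= k w IH i; rewrite IH mulA. Qed.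

Lemma smono_evalM p q :
  smono_eval (p.1 * q.1, p.2 ++ q.2) = smono_eval p * smono_eval q.
Proof. by rewrite /smono_eval big_cat /= mulrACA. Qed.

Lemma snormP k : seval k = \sum_(p <- snorm k) smono_eval p.
Proof.
elim: k => [i|c|a IHa b IHb|a IHa|a IHa b IHb] /=; rewrite ?IHa ?IHb.
- by rewrite big_seq1 /smono_eval big_seq1 mul1r.
- by rewrite big_seq1 /smono_eval big_nil mulr1.
- by rewrite big_cat.
- by rewrite big_map -sumrN; apply: eq_bigr => p _; rewrite /smono_eval mulNr.
- rewrite big_allpairs_dep big_distrl; apply: eq_bigr => p _ /=.
  by rewrite big_distrr; apply: eq_bigr => q _ /=; rewrite smono_evalM.
Qed.

Lemma mul_suml (I : Type) (s : seq I) (f : I -> R) y :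
  mul (\sum_(i <- s) f i) y = \sum_(i <- s) mul (f i) y.
Proof. by elim: s => [|i s IH]; rewrite ?big_nil ?mul0x // !big_cons mulDl IH. Qed.

Lemma mul_sumr (I : Type) (s : seq I) (f : I -> R) y :
  mul y (\sum_(i <- s) f i) = \sum_(i <- s) mul y (f i).
Proof. by elim: s => [|i s IH]; rewrite ?big_nil ?mulx0 // !big_cons mulDr IH. Qed.

Lemma rnormP t : reval t = \sum_(p <- rnorm t) rmono_eval p.
Proof.
elim: t => [i||a IHa b IHb|a IHa|a IHa b IHb|a IHa k] /=; rewrite ?IHa ?IHb.
- by rewrite big_seq1 /rmono_eval /smono_eval big_nil.
- by rewrite big_nil.
- by rewrite big_cat.
- rewrite big_map -sumrN; apply: eq_bigr => p _.
  by rewrite /rmono_eval /smono_eval mulNr mulrNz.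
- rewrite big_allpairs_dep mul_suml; apply: eq_bigr => p _ /=.
  rewrite mul_sumr; apply: eq_bigr => q _ /=.
  rewrite /rmono_eval mulzx mulxz word_eval_cat -mulrzA; congr (_ *~ _).
  by rewrite (smono_evalM (p.1, p.2.1) (q.1, q.2.1)) mulrC.
- rewrite snormP big_allpairs_dep mulrz_suml; apply: eq_bigr => p _ /=.
  rewrite mulrz_sumr; apply: eq_bigr => q _ /=.
  by rewrite /rmono_eval -mulrzA -(smono_evalM (p.1, p.2.1)).
Qed.

Lemma rmono_insertP p l :
  \sum_(q <- rmono_insert p l) rmono_eval q
  = rmono_eval p + \sum_(q <- l) rmono_eval q.
Proof.
elim: l => [|q l IH] /=; first by rewrite big_seq1 big_nil addr0.
case: eqP => [E|_]; rewrite !big_cons; last by rewrite IH addrCA.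
by rewrite addrA /rmono_eval /smono_eval /= E mulrDl mulrzDr.
Qed.

Lemma rmono_sortP p : rmono_eval (rmono_sort p) = rmono_eval p.
Proof.
rewrite /rmono_eval /smono_eval /=; congr (_ *~ (_ * _)).
by apply: perm_big; rewrite perm_sort.
Qed.

Lemma rcollectP l :
  \sum_(q <- rcollect l) rmono_eval q = \sum_(q <- l) rmono_eval q.
Proof.
elim: l => [|p l IH] //=.
by rewrite rmono_insertP rmono_sortP IH big_cons.
Qed.

Lemma rnullP t : rnull t -> reval t = 0.
Proof.
rewrite rnormP -rcollectP /rnull.
elim: (rcollect _) => [|p l IH] /=; first by rewrite big_nil.
case/andP=> /eqP p0 /IH l0.
by rewrite big_cons l0 /rmono_eval /smono_eval /= p0 mul0r addr0.
Qed.

Lemma rnull_eq a b : rnull (RAdd a (ROpp b)) -> reval a = reval b.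
Proof. by move/rnullP/eqP; rewrite subr_eq0 => /eqP. Qed.

End Soundness.

(** * Reification of ring terms *)

Ltac mem_list x l :=
  lazymatch l with
  | nil => constr:(false)
  | cons x _ => constr:(true)
  | cons _ ?l' => mem_list x l'
  end.

Ltac add_list x l :=
  lazymatch mem_list x l with true => l | false => constr:(cons x l) end.

Ltac index_list x l :=
  lazymatch l with
  | cons x _ => constr:(O)
  | cons _ ?l' => let i := index_list x l' in constr:(S i)
  end.

(** Integer literals stay constants; any other leaf, such as [Posz m] with [m] a variable, becomes
    an atom. *)
Ltac satoms k l :=
  lazymatch k with
  | @GRing.add _ ?a ?b => let l' := satoms a l in satoms b l'
  | @GRing.mul _ ?a ?b => let l' := satoms a l in satoms b l'
  | @GRing.opp _ ?a => satoms a l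
  | Posz (S _) => l
  | Posz O => l
  | _ => add_list k l
  end.

Ltac sreify k l :=
  lazymatch k with
  | @GRing.add _ ?a ?b =>
      let a' := sreify a l in let b' := sreify b l in constr:(SAdd a' b')
  | @GRing.mul _ ?a ?b =>
      let a' := sreify a l in let b' := sreify b l in constr:(SMul a' b')
  | @GRing.opp _ ?a => let a' := sreify a l in constr:(SOpp a')
  | Posz (S _) => constr:(SConst k)
  | Posz O => constr:(SConst k)
  | _ => let i := index_list k l in constr:(SVar i)
  end.

(* [ls] is a pair (ring atoms, scalar atoms). *)
Ltac ratoms mul t ls :=
  lazymatch t with
  | @GRing.add _ ?a ?b => let ls' := ratoms mul a ls in ratoms mul b ls'
  | mul ?a ?b => let ls' := ratoms mul a ls in ratoms mul b ls'
  | @GRing.opp _ ?a => ratoms mul a ls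
  | @GRing.zero _ => ls
  | @intmul _ ?a ?k =>
      lazymatch ratoms mul a ls with
      | (?l, ?l') => let l'' := satoms k l' in constr:((l, l''))
      end
  | _ => lazymatch ls with
         | (?l, ?l') => let l1 := add_list t l in constr:((l1, l'))
         end
  end.

Ltac rreify mul t l l' :=
  lazymatch t with
  | @GRing.add _ ?a ?b =>
      let a' := rreify mul a l l' in let b' := rreify mul b l l' in
      constr:(RAdd a' b')
  | mul ?a ?b =>
      let a' := rreify mul a l l' in let b' := rreify mul b l l' in
      constr:(RMul a' b')
  | @GRing.opp _ ?a => let a' := rreify mul a l l' in constr:(ROpp a')
  | @GRing.zero _ => constr:(RZero)
  | @intmul _ ?a ?k =>
      let a' := rreify mul a l l' in let k' := sreify k l' in
      constr:(RScale a' k')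
  | _ => let i := index_list t l in constr:(RVar i)
  end.

Ltac nc_ring H :=
  lazymatch type of H with
  | @assoc_ring ?R ?mul =>
    lazymatch goal with
    | |- ?a = ?b =>
      let ls := ratoms mul a (@nil R, @nil int) in
      lazymatch ratoms mul b ls with
      | (?l, ?l') =>
        let a' := rreify mul a l l' in
        let b' := rreify mul b l l' in
        change (@reval R mul l l' a' = @reval R mul l l' b');
        apply: (@rnull_eq R mul H l l' a' b'); vm_compute; reflexivity
      end
    end
  end.

(** * Linear combinations of identities *)

Section LinearCombination.
Variables (R : zmodType) (mul : R -> R -> R).
Implicit Types a b c d : R.

Lemma eqD a b c d : a = b -> c = d -> a + c = b + d.
Proof. by move=> -> ->. Qed.

Lemma eqB a b c d : a = b -> c = d -> a - c = b - d.
Proof. by move=> -> ->. Qed.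

Lemma eqMl u a b : a = b -> mul u a = mul u b.
Proof. by move=> ->. Qed.

Lemma eqMr u a b : a = b -> mul a u = mul b u.
Proof. by move=> ->. Qed.

Lemma eqZ (k : int) a b : a = b -> a *~ k = b *~ k.
Proof. by move=> ->. Qed.

(** Here [c = d] is a combination of known identities, and [a - b = c - d] a formal identity left to
    normalization. *)
Lemma linear_comb a b c d : c = d -> a - b = c - d -> a = b.
Proof. by move=> -> /eqP; rewrite subrr subr_eq0 => /eqP. Qed.

End LinearCombination.

Arguments eqMl {R} mul u {a b}.
Arguments eqMr {R} mul u {a b}.
Arguments eqZ {R} k {a b}.

Tactic Notation "linear" "combination" uconstr(p) "in" constr(H) :=
  refine (linear_comb p _); nc_ring H.

(** * Cancellable integer scalars *)

Section Regular.
Variable R : zmodType.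

Definition regular (k : int) : Prop := forall a : R, a *~ k = 0 -> a = 0.

Lemma regular_eq k (a b : R) : regular k -> a *~ k = b *~ k -> a = b.
Proof.
by move=> kr ab; apply/eqP; rewrite -subr_eq0; apply/eqP/kr; rewrite mulrzBl ab subrr.
Qed.

Lemma regularM k l : regular k -> regular l -> regular (k * l).
Proof. by move=> kr lr a; rewrite mulrzA => /lr/kr. Qed.

Lemma regularN k : regular k -> regular (- k).
Proof. by move=> kr a; rewrite mulrNz => /eqP; rewrite oppr_eq0 => /eqP/kr. Qed.

Lemma torsion_free_regular k l : (k %| l)%N -> torsion_free R l -> regular (Posz k).
Proof.
case/dvdnP=> q -> tf a; rewrite -pmulrn => ak0; apply: tf.
by rewrite mulnC mulrnA ak0 mul0rn.
Qed.

End Regular.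

(** * Jordan derivations *)

Section AssocRing.
Variables (R : zmodType) (mul : R -> R -> R).
Hypothesis Hring : assoc_ring mul.

Local Infix "**" := mul (at level 40, left associativity).
Local Notation "{[ a , b ]}" := (a ** b - b ** a).
Local Notation "u [l] p" := (eqMl mul u p) (at level 40, left associativity).
Local Notation "p [r] u" := (eqMr mul u p) (at level 40, left associativity).
Local Notation "k [s] p" := (eqZ k p) (at level 45, right associativity).
Local Notation "p [+] q" := (eqD p q) (at level 50, left associativity).
Local Notation "p [-] q" := (eqB p q) (at level 50, left associativity).
Tactic Notation "comb" uconstr(p) := linear combination p in Hring.
Ltac nc := nc_ring Hring.
Local Notation reg := (@regular R).

(* Every identity satisfied by such a map comes from the Jordan identity
   (x^2 o y) o x = x^2 o (y o x), both sides of which T expands differently. *)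
Lemma twisted_jordan (s p q : int) (T : R -> R) (Tadd : additive_map T)
    (HT : forall x, T (x ** x) *~ s = T x ** x *~ p + x ** T x *~ q) x y :
  let A u v := v ** u *~ p + u ** v *~ q in
  A (x ** x ** y + y ** x ** x) (T x) *~ (s * s)
  + A x (A y (A x (T x)))
  = A (x ** y + y ** x) (A x (T x)) *~ s + A (x ** x) (A y (T x)) *~ s.
Proof.
move=> A.
have HT2 u v : T (u ** v + v ** u) *~ s = A u (T v) + A v (T u).
  have E : (u + v) ** (u + v) = u ** u + (u ** v + v ** u) + v ** v by nc.
  have := HT (u + v); rewrite E !Tadd /A => H.
  comb (H [-] HT u [-] HT v).
have E : x ** x ** (x ** y + y ** x) + (x ** y + y ** x) ** (x ** x)
       = x ** (x ** x ** y + y ** (x ** x)) + (x ** x ** y + y ** (x ** x)) ** x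
  by nc.
have H1 := HT x; have H2 := HT2 x y; have H3 := HT2 (x ** x) y.
have H4 := HT2 (x ** x) (x ** y + y ** x); have H5 := HT2 x (x ** x ** y + y ** (x ** x)).
rewrite {}E in H4; rewrite /A in H1 H2 H3 H4 H5 *.
(* The terms in [T y] cancel, because the operators [A x] and [A (x ** x)] commute. *)
comb ((s * s [s] (H4 [-] H5))
  [-] (s [s] ((p [s] H3 [r] x) [+] (q [s] x [l] H3)))
  [-] (p [s] ((p [s] H1 [r] y) [+] (q [s] y [l] H1)) [r] x)
  [-] (q [s] x [l] ((p [s] H1 [r] y) [+] (q [s] y [l] H1)))
  [+] (s [s] ((p [s] H2 [r] (x ** x)) [+] (q [s] (x ** x) [l] H2)))
  [+] (s [s] ((p [s] H1 [r] (x ** y + y ** x)) [+] (q [s] (x ** y + y ** x) [l] H1)))).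
Qed.

Lemma additive_mapB (T : R -> R) : additive_map T -> forall u v, T (u - v) = T u - T v.
Proof.
move=> Tadd u v; apply/eqP; rewrite eq_sym subr_eq -Tadd; apply/eqP.
by rewrite subrK.
Qed.

Section Semiprime.
Hypothesis Hsp : semiprime mul.

Lemma semiprime_cube a : (forall y z, a ** y ** a ** z ** a = 0) -> a = 0.
Proof.
move=> H; apply: Hsp => y; apply: Hsp => z.
comb (H y z [r] (y ** a)).
Qed.

Section MNJordan.
Variables M N : int.
Hypothesis reg2 : reg (Posz 2).
Hypothesis reg3 : reg (Posz 3).
Hypothesis regM : reg M.
Hypothesis regN : reg N.
Hypothesis regS : reg (M + N).
Hypothesis regB : reg (M - N).

Variable D : R -> R.
Hypothesis Dadd : additive_map D.
Hypothesis HD : forall x,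
  D (x ** x) *~ (M + N) = D x ** x *~ (Posz 2 * M) + x ** D x *~ (Posz 2 * N).

(** * Vanishing of [[D x, x], x] *)

Local Notation e x := {[D x, x]}.
Local Notation f x := {[e x, x]}.

(** [twisted_jordan] carries a common factor 2(M - N) here. No value of [D] other than [D x] occurs,
    so [y] may be replaced by any product. *)
Lemma mn_jordan x y :
  (D x ** {[{[y, x]}, x]} *~ M - {[{[y, x]}, x]} ** D x *~ N) *~ (M + N)
  + {[{[e x, y]}, x]} *~ (Posz 2 * M * N) = 0.
Proof.
have := twisted_jordan Dadd HD x y; cbv zeta beta => H.
apply: (regular_eq (regularM reg2 regB)).
comb (- Posz 1 [s] H).
Qed.

Lemma comm_f x : {[f x, x]} = 0.
Proof.
apply: (regular_eq (regularM (regularM reg2 regM) regN)).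
comb (mn_jordan x x).
Qed.

(** Since c commutes with left multiplication by x, passing from y to xy leaves only the commutators
    of x with d and e. *)
Lemma e_comm2 x y :
  e x ** {[{[y, x]}, x]} *~ (M + N) + f x ** {[y, x]} *~ (Posz 2 * N) = 0.
Proof.
apply: (regular_eq regM).
comb (mn_jordan x (x ** y) [-] x [l] mn_jordan x y [-] (Posz 2 * M * N [s] comm_f x [r] y)).
Qed.

Lemma comm2_e x y :
  {[{[y, x]}, x]} ** e x *~ (M + N) + {[y, x]} ** f x *~ (Posz 2 * M) = 0.
Proof.
apply: (regular_eq regN).
comb (mn_jordan x (y ** x) [-] mn_jordan x y [r] x [-] (Posz 2 * M * N [s] y [l] comm_f x)).
Qed.

(** Apply the derivation c to [e_comm2] and subtract [e_comm2] at c(y): the terms e c^3(y)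
    cancel. *)
Lemma f_comm2 x y : f x ** {[{[y, x]}, x]} = 0.
Proof.
apply: (regular_eq regS).
comb (e_comm2 x y [r] x [-] x [l] e_comm2 x y [-] e_comm2 x {[y, x]}
  [-] (Posz 2 * N [s] comm_f x [r] {[y, x]})).
Qed.

(** Leibniz: c^2(yz) = c^2(y) z + 2 c(y) c(z) + y c^2(z). *)
Lemma f_comm_comm x y z :
  f x ** {[y, x]} ** {[z, x]} *~ Posz 2 = - (f x ** y ** {[{[z, x]}, x]}).
Proof. comb (f_comm2 x (y ** z) [-] f_comm2 x y [r] z). Qed.

Lemma f_comm_comm2 x y z : f x ** {[y, x]} ** {[{[z, x]}, x]} = 0.
Proof.
comb (f_comm_comm x {[y, x]} z [-] (Posz 2 [s] f_comm2 x y [r] {[z, x]})).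
Qed.

Lemma f_mul_comm3 x y z : f x ** y ** {[{[{[z, x]}, x]}, x]} = 0.
Proof.
comb (f_comm_comm x y {[z, x]} [-] (Posz 2 [s] f_comm_comm2 x y z)).
Qed.

Lemma f_mul_f_comm x y z : f x ** y ** (f x ** {[z, x]}) = 0.
Proof.
have H : f x ** y ** (f x ** {[z, x]} + e x ** {[{[z, x]}, x]}) = 0.
  (* The 3 is the binomial coefficient in c^3(dz), where c(d) = e, c^2(d) = f and c^3(d) = 0. *)
  apply: (regular_eq reg3).
  comb (f_mul_comm3 x y (D x ** z) [-] f_mul_comm3 x (y ** D x) z
    [-] (f x ** y) [l] comm_f x [r] z).
apply: (regular_eq regB).
comb (((M + N) [s] H) [-] (f x ** y) [l] e_comm2 x z).
Qed.

Lemma comm2_D x : f x = 0.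
Proof.
apply: semiprime_cube => y z.
comb (f_mul_f_comm x y (z ** e x) [-] f_mul_f_comm x y z [r] e x).
Qed.

(** * Vanishing of [D x, x] *)

Lemma e_comm2_0 x y : e x ** {[{[y, x]}, x]} = 0.
Proof.
apply: (regular_eq regS).
comb (e_comm2 x y [-] (Posz 2 * N [s] comm2_D x [r] {[y, x]})).
Qed.

Lemma comm2_e_0 x y : {[{[y, x]}, x]} ** e x = 0.
Proof.
apply: (regular_eq regS).
comb (comm2_e x y [-] (Posz 2 * M [s] {[y, x]} [l] comm2_D x)).
Qed.

Lemma e_comm_e x y : e x ** {[y, x]} ** e x = 0.
Proof.
apply: (regular_eq reg2).
comb (e_comm2_0 x (y ** D x) [-] e_comm2_0 x y [r] D x [-] (e x ** y) [l] comm2_D x).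
Qed.

(** Compare [mn_jordan] at ye with its right multiple by e: the two differ in the order of d and e
    after c^2(y), and c^2(y) e = 0. *)
Lemma comm2_D_e x y : {[{[y, x]}, x]} ** D x ** e x = 0.
Proof.
apply: (regular_eq (regularM regS regN)).
have W : {[y, x]} ** f x *~ Posz 2 + y ** {[f x, x]} = 0.
  comb ((Posz 2 [s] {[y, x]} [l] comm2_D x) [+] y [l] comm_f x).
comb (mn_jordan x (y ** e x) [-] mn_jordan x y [r] e x
  [-] ((M + N) [s] ((M [s] D x [l] W) [-] (N [s] W [r] D x)))
  [-] (Posz 2 * M * N [s] {[e x, y]} [l] comm2_D x)
  [+] ((M + N) * N [s] comm2_e_0 x y [r] D x)).
Qed.

Lemma comm_e_e x y : {[y, x]} ** e x ** e x = 0.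
Proof.
apply: (regular_eq (regularM (regularM reg2 regM) regN)).
comb (((M + N) [s] ((M [s] D x [l] comm2_e_0 x y) [-] (N [s] comm2_D_e x y)))
  [+] (Posz 2 * M * N [s] (comm2_D x [r] (y ** e x) [-] y [l] comm2_D x [r] e x
                           [+] e_comm_e x y))
  [-] mn_jordan x y [r] e x).
Qed.

Lemma e_square x : e x ** e x = 0.
Proof.
apply: Hsp => y.
comb (e x [l] (comm_e_e x (D x ** y) [-] D x [l] comm_e_e x y)).
Qed.

Lemma comm2_D_linearized x y :
  {[e x, y]} + {[{[D x, y]}, x]} + {[{[D y, x]}, x]} = 0.
Proof.
apply: (regular_eq reg2).
have := comm2_D (x + y); rewrite Dadd => H1.
have := comm2_D (x - y); rewrite (additive_mapB Dadd) => H2.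
(* The difference keeps the part odd in [y]; its cubic part is 2 f(y) = 0. *)
comb (H1 [-] H2 [-] (Posz 2 [s] comm2_D y)).
Qed.

(** Left multiplication by e kills the term in [D y] of the linearized identity, by [e_comm2_0] at
    [D y]. *)
Lemma e_mul_e x y :
  e x ** y ** e x *~ Posz 2 = e x ** D x ** {[y, x]} - e x ** {[y, x]} ** D x.
Proof.
comb (e_comm2_0 x (D y) [-] e x [l] comm2_D_linearized x y [+] (Posz 2 [s] e_square x [r] y)).
Qed.

Lemma e_mul_e' x y :
  e x ** y ** e x *~ Posz 2 = {[y, x]} ** D x ** e x - D x ** {[y, x]} ** e x.
Proof.
comb (comm2_D_linearized x y [r] e x [-] comm2_e_0 x (D y) [+] (Posz 2 [s] y [l] e_square x)).
Qed.

Lemma e_mul_De x y :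
  e x ** y ** D x ** e x *~ Posz 2 = e x ** y ** e x ** D x + e x ** D x ** y ** e x.
Proof. comb (e_mul_e x (y ** D x) [-] e_mul_e x y [r] D x). Qed.

Lemma eD_mul_e x y :
  e x ** D x ** y ** e x *~ Posz 2 = D x ** e x ** y ** e x + e x ** y ** D x ** e x.
Proof. comb (e_mul_e' x (D x ** y) [-] D x [l] e_mul_e' x y). Qed.

(** Expanding 2 e d y e z e in two ways gives e y d e z e = e y e z d e; the two exchange rules
    after e y then turn this into 2 e y e z (de - ed) = 0. *)
Lemma e_e_comm x y z : e x ** y ** e x ** z ** {[D x, e x]} = 0.
Proof.
apply: (regular_eq reg2).
comb (eD_mul_e x (y ** e x ** z) [-] eD_mul_e x y [r] (z ** e x)
  [+] (e x ** y) [l] (eD_mul_e x z [+] (Posz 2 [s] e_mul_De x z))).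
Qed.

(** Expanding the first two factors of q y q z q, with q = [d, e], gives four terms, each killed by
    [e_e_comm]. *)
Lemma D_comm_e x : {[D x, e x]} = 0.
Proof.
apply: semiprime_cube => y z.
comb (D x [l] e_e_comm x (y ** D x) z [-] D x [l] e_e_comm x y (D x ** z)
  [-] e_e_comm x (D x ** y ** D x) z [+] e_e_comm x (D x ** y) (D x ** z)).
Qed.

(** The formulas for 2 e y e and 2 e z e add up to 4 e y e z e; [e_comm_e] at y d z removes one
    copy, and the remaining terms cancel because d and e commute. *)
Lemma e_cube x y z : e x ** y ** e x ** z ** e x = 0.
Proof.
apply: (regular_eq reg3).
comb ((e x ** y) [l] e_mul_e' x z
  [+] (e x ** y ** {[z, x]}) [l] D_comm_e x [+] e_comm_e x (y ** z) [r] D x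
  [-] e_comm_e x (y ** D x ** z) [+] e_mul_e x y [r] (z ** e x)
  [+] (Posz 2 [s] (e x ** {[y, x]} ** z) [l] D_comm_e x)
  [-] e_mul_De x ({[y, x]} ** z)).
Qed.

Lemma comm_D x : e x = 0.
Proof. by apply: semiprime_cube => y z; apply: e_cube. Qed.

(** * Centrality of the values of D *)

Lemma comm_D_linearized x y : {[D x, y]} = {[x, D y]}.
Proof.
have := comm_D (x + y); rewrite Dadd => H.
comb (H [-] comm_D x [-] comm_D y).
Qed.

Lemma D_square x : D (x ** x) = D x ** x + x ** D x.
Proof.
apply: (regular_eq regS).
comb (HD x [+] ((M - N) [s] comm_D x)).
Qed.

Lemma D_jordan x y :
  D (x ** y + y ** x) = D x ** y + y ** D x + x ** D y + D y ** x.
Proof.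
have E : (x + y) ** (x + y) = x ** x + (x ** y + y ** x) + y ** y by nc.
have := D_square (x + y); rewrite E !Dadd => H.
comb (H [-] D_square x [-] D_square y).
Qed.

(** Expand [D(x^2), y] = [x^2, D y] by the Jordan rule and [x, D y] = [d, y]. *)
Lemma D_anticomm x y : D x ** {[y, x]} + {[y, x]} ** D x = 0.
Proof.
comb (x [l] comm_D_linearized x y [+] comm_D_linearized x y [r] x
  [+] D_square x [r] y [-] y [l] D_square x [-] comm_D_linearized (x ** x) y).
Qed.

Lemma D_comm2 x y : D x ** {[{[y, x]}, x]} = 0.
Proof.
apply: (regular_eq (regularM regS regS)).
have H : {[{[e x, y]}, x]} = 0.
  comb ((comm_D x [r] y [-] y [l] comm_D x) [r] x
        [-] x [l] (comm_D x [r] y [-] y [l] comm_D x)).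
comb (mn_jordan x y [+] ((M + N) * N [s] D_anticomm x {[y, x]})
  [-] (Posz 2 * M * N [s] H)).
Qed.

Lemma D_anticomm_linearized x y z :
  D x ** {[y, z]} + {[y, z]} ** D x + D z ** {[y, x]} + {[y, x]} ** D z = 0.
Proof.
have := D_anticomm (x + z) y; rewrite Dadd => H.
comb (H [-] D_anticomm x y [-] D_anticomm z y).
Qed.

Lemma comm_exchange x y z : {[y, x]} ** {[z, D x]} = {[y, D x]} ** {[z, x]}.
Proof.
comb (D_anticomm x (y ** z) [-] D_anticomm x y [r] z [-] y [l] D_anticomm x z).
Qed.

Lemma comm_exchange_mul x y w z :
  {[y, x]} ** w ** {[z, D x]} = {[y, D x]} ** w ** {[z, x]}.
Proof. comb (comm_exchange x (y ** w) z [-] y [l] comm_exchange x w z). Qed.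

(** Put p = [y, x]. Anticommutation gives d[p, d] = -2ddp, while d[p, x] = 0, so the exchange rule
    yields 2 ddp w ddp = 0. *)
Lemma DD_comm x y : D x ** D x ** {[y, x]} = 0.
Proof.
apply: Hsp => w; apply: (regular_eq reg2).
comb ((D x [l] comm_exchange_mul x {[y, x]} (w ** (D x ** D x)) y)
  [-] D_comm2 x y [r] (w ** (D x ** D x) ** {[y, D x]})
  [+] D x [l] D_anticomm x y [r] (w ** (D x ** D x) ** {[y, x]})).
Qed.

Lemma comm_jordan x y z :
  {[{[{[y, x]}, x]}, D z]} + {[{[D x, z]}, {[y, x]}]} *~ Posz 2
  + {[{[{[y, x]}, D x]}, z]} = 0.
Proof.
comb (D_anticomm_linearized x y (x ** z + z ** x)
  [-] D_jordan x z [r] {[y, x]} [-] {[y, x]} [l] D_jordan x z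
  [-] x [l] D_anticomm_linearized x y z [-] D_anticomm_linearized x y z [r] x
  [-] (Posz 2 [s] (z [l] D_anticomm x y [+] D_anticomm x y [r] z))
  [-] (comm_D x [r] {[y, z]} [-] {[y, z]} [l] comm_D x)).
Qed.

Lemma DD_comm_skew x y z :
  D x ** y ** D x ** {[z, x]} + D x ** z ** D x ** {[y, x]} = 0.
Proof.
apply: (regular_eq reg2).
comb (D x [l] comm_jordan x y z [-] D_comm2 x y [r] D z
  [+] (D_comm2 x (D z ** y) [-] D_comm2 x (D z) [r] y)
  [-] (Posz 2 [s] D x [l] comm_D_linearized x z [r] {[y, x]})
  [-] D x [l] D_anticomm x y [r] z
  [+] (Posz 2 [s] DD_comm x y [r] z)
  [+] (D x ** z) [l] D_anticomm x y
  [-] (Posz 2 [s] D x [l] comm_exchange x y z)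
  [+] (Posz 2 [s] (DD_comm x (y ** z) [-] DD_comm x y [r] z))).
Qed.

(** In [DD_comm_skew] at z d w, Leibniz leaves only z d c(w): c(d) = 0, and d moves past c(z) to
    form d d c(z) = 0. *)
Lemma DDD_comm_skew x y z w :
  D x ** y ** D x ** z ** D x ** {[w, x]}
  = - (D x ** z ** D x ** w ** D x ** {[y, x]}).
Proof.
comb (DD_comm_skew x y (z ** D x ** w)
  [-] (D x ** y ** D x ** z) [l] comm_D x [r] w
  [-] (D x ** y ** D x) [l] D_anticomm x z [r] w
  [+] (D x ** y) [l] DD_comm x z [r] w).
Qed.

(* The skew symmetry is cyclic of odd order, hence forces a zero. *)
Lemma DDD_comm x y z w : D x ** y ** D x ** z ** D x ** {[w, x]} = 0.
Proof.
apply: (regular_eq reg2).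
comb (DDD_comm_skew x y z w [-] DDD_comm_skew x z w y [+] DDD_comm_skew x w y z).
Qed.

Lemma D_comm x w : D x ** {[w, x]} = 0.
Proof.
apply: semiprime_cube => y z.
comb (DDD_comm x ({[w, x]} ** y) ({[w, x]} ** z) w).
Qed.

Lemma D_mul_comm x z w : D x ** z ** {[w, x]} = 0.
Proof. comb (D_comm x (z ** w) [-] D_comm x z [r] w). Qed.

(** Linearizing in x swaps x and y up to sign; one swap inside a t a produces a factor killed by
    [D_mul_comm]. *)
Lemma D_mul_comm_all x y z w : D x ** z ** {[w, y]} = 0.
Proof.
have H : D x ** z ** {[w, y]} + D y ** z ** {[w, x]} = 0.
  have := D_mul_comm (x + y) z w; rewrite Dadd => H.
  comb (H [-] D_mul_comm x z w [-] D_mul_comm y z w).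
apply: Hsp => t.
comb ((D x ** z ** {[w, y]} ** t) [l] H
  [-] D_mul_comm x (z ** {[w, y]} ** t ** D y ** z) w).
Qed.

Lemma D_central x y : D x ** y = y ** D x.
Proof.
apply/eqP; rewrite -subr_eq0; apply/eqP; apply: Hsp => t.
comb (D_mul_comm_all x y (y ** t) (D x) [-] y [l] D_mul_comm_all x y t (D x)).
Qed.

(** * Vanishing on commutators and the Leibniz rule *)

Lemma D_comm_all x y w : D x ** {[w, y]} = 0.
Proof. by apply: Hsp => t; comb (D_mul_comm_all x y ({[w, y]} ** t ** D x) w). Qed.

Lemma D_of_comm x y : D {[x, y]} = 0.
Proof.
set u := {[x, y]}.
have Duu v : D v ** u = 0 by apply: D_comm_all.
have D0 : D 0 = 0 by apply: (addrI (D 0)); rewrite -Dadd !addr0.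
have u0 : D u ** u + u ** D u = 0 by rewrite -D_central Duu addr0.
(* As D(v) u = 0 for all v and D(v) is central, this reduces to 2 D(u)^2 = 0; centrality then gives
   D(u) t D(u) = 0. *)
have H := D_jordan (D u) u; rewrite u0 D0 in H.
apply: Hsp => t; apply: (regular_eq reg2).
comb (D_central (D u) u [r] t [-] H [r] t [-] (Posz 2 [s] Duu (D u) [r] t)
  [-] (Posz 2 [s] D u [l] D_central u t)).
Qed.

Lemma D_derivation : derivation mul D.
Proof.
move=> x y; apply: (regular_eq reg2).
have H : D (x ** y) + D (x ** y) = D (x ** y + y ** x) + D {[x, y]}.
  by rewrite -!Dadd; congr D; nc.
comb (H [+] D_jordan x y [+] D_of_comm x y [-] D_central x y [+] D_central y x).
Qed.

End MNJordan.

(** * The difference F - D *)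

Section OneSided.
Variables M N : int.
Hypothesis reg2 : reg (Posz 2).
Hypothesis regM : reg M.
Hypothesis regN : reg N.
Hypothesis regS : reg (M + N).
Hypothesis regB : reg (M - N).

Variable G : R -> R.
Hypothesis Gadd : additive_map G.
Hypothesis HG : forall x, G (x ** x) *~ (M + N) = G x ** x *~ (Posz 2 * M).

(** [twisted_jordan] with q = 0, after cancelling 2M(M - N). *)
Lemma G_jordan x y :
  G x ** (x ** x ** y + y ** x ** x) *~ (M + N)
  = G x ** x ** y ** x *~ (Posz 2 * M).
Proof.
have HG' z : G (z ** z) *~ (M + N) = G z ** z *~ (Posz 2 * M) + z ** G z *~ Posz 0.
  comb (HG z).
have := twisted_jordan Gadd HG' x y; cbv zeta beta => H.
apply: (regular_eq (regularM (regularM reg2 regM) regB)).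
comb (- Posz 1 [s] H).
Qed.

Lemma G_mul_cube x : G x ** x ** x ** x = 0.
Proof.
apply: (regular_eq (regularM reg2 regN)).
comb (G_jordan x x).
Qed.

Lemma G_mul_square x : G x ** x ** x = 0.
Proof.
apply: Hsp => y; apply: (regular_eq regS).
comb (G_jordan x (x ** x ** y ** G x)
  [-] ((M + N) [s] G_mul_cube x [r] (x ** y ** G x))
  [+] (Posz 2 * M [s] G_mul_cube x [r] (y ** G x ** x))).
Qed.

Lemma G_mul x : G x ** x = 0.
Proof.
apply: Hsp => y; apply: (regular_eq (regularM reg2 regM)).
comb (((M + N) [s] (G_mul_square x [r] (y ** G x) [+] (G x ** y) [l] G_mul_square x))
  [-] G_jordan x (y ** G x)).
Qed.

Lemma G_mul_linearized x y : G x ** y = - (G y ** x).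
Proof.
have := G_mul (x + y); rewrite Gadd => H.
comb (H [-] G_mul x [-] G_mul y).
Qed.

Lemma G_square x : G (x ** x) = 0.
Proof.
apply: (regular_eq regS).
comb (HG x [+] (Posz 2 * M [s] G_mul x)).
Qed.

(** G kills yz + zy, and G(x) v = -G(v) x. *)
Lemma G_mul_skew x y z : G x ** y ** z = - (G x ** z ** y).
Proof.
have H : G (y ** z + z ** y) = 0.
  have E : (y + z) ** (y + z) = y ** y + (y ** z + z ** y) + z ** z by nc.
  have := G_square (y + z); rewrite E (Gadd _ (z ** z)) (Gadd (y ** y)) !G_square => H.
  comb H.
comb (G_mul_linearized x (y ** z + z ** y) [-] H [r] x).
Qed.

Lemma one_sided_eq0 x : G x = 0.
Proof.
(* Each cyclic shift of a, b, c changes the sign; three shifts restore the word, so it equals its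
   opposite. *)
have H a b c : G x ** a ** b ** c = 0.
  apply: (regular_eq reg2).
  comb (G_mul_skew x (a ** b) c [-] G_mul_skew x (c ** a) b
    [+] G_mul_skew x (b ** c) a).
apply: semiprime_cube => y z.
comb (H y (G x) z [r] G x).
Qed.

End OneSided.
End Semiprime.
End AssocRing.

Theorem theorem2p4 (R : zmodType) (mul : R -> R -> R) (m n : nat)
  (Hring : assoc_ring mul)
  (Hm : (1 <= m)%N) (Hn : (1 <= n)%N) (Hmn : m <> n)
  (Hsp : semiprime mul)
  (Htf : torsion_free R (m * n * (m + n) * (maxn m n - minn m n))%N)
  (F : R -> R) (HF : gen_mn_jordan_derivation mul m n F) :
  derivation mul F /\ (forall x, in_center mul (F x)).
Proof.
have reg k : (k %| m * n * (m + n) * (maxn m n - minn m n))%N -> regular R (Posz k).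
  by move=> kl; apply: torsion_free_regular kl Htf.
(* 6 always divides mn(m+n)|m-n|. *)
have reg2 : regular R (Posz 2) by apply: reg; rewrite !Euclid_dvdM //; lia.
have reg3 : regular R (Posz 3) by apply: reg; rewrite !Euclid_dvdM //; lia.
have regM : regular R (Posz m) by apply: reg; rewrite -!mulnA dvdn_mulr.
have regN : regular R (Posz n).
  by apply: reg; rewrite (mulnC m) -!mulnA dvdn_mulr.
have regS : regular R (Posz m + Posz n).
  by rewrite -PoszD; apply: reg; rewrite dvdn_mulr // dvdn_mull.
have regB : regular R (Posz m - Posz n).
  (* The last factor is |n - m|, which agrees with m - n only up to sign. *)
  have := reg _ (dvdn_mull _ (dvdnn _)); case: leqP => mn; last first.
    by rewrite subzn // ltnW.
  by rewrite -opprB subzn // => /regularN.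
case: HF => Fadd [D [[Dadd HD] HFD]].
have natz (a : R) i : a *+ i = a *~ Posz i by rewrite -pmulrn.
have HD' x : D (mul x x) *~ (Posz m + Posz n)
    = mul (D x) x *~ (Posz 2 * Posz m) + mul x (D x) *~ (Posz 2 * Posz n).
  by rewrite -PoszD -!PoszM -!natz HD.
have HG x : (F (mul x x) - D (mul x x)) *~ (Posz m + Posz n)
    = mul (F x - D x) x *~ (Posz 2 * Posz m).
  have HF' : F (mul x x) *~ (Posz m + Posz n)
      = mul (F x) x *~ (Posz 2 * Posz m) + mul x (D x) *~ (Posz 2 * Posz n).
    by rewrite -PoszD -!PoszM -!natz HFD.
  (* The terms in x D(x) are the same for [F] and [D] and cancel, so [F - D] obeys a one-sided
     identity. *)
  linear combination (eqB HF' (HD' x)) in Hring.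
have Gadd : additive_map (fun x => F x - D x).
  by move=> x y; rewrite Fadd Dadd opprD addrACA.
have FD x : F x = D x.
  apply/eqP; rewrite -subr_eq0; apply/eqP.
  exact: (one_sided_eq0 Hring Hsp reg2 regM regN regS regB Gadd HG x).
split=> [x y|x y]; rewrite !FD.
  exact: (D_derivation Hring Hsp reg2 reg3 regM regN regS regB Dadd HD').
exact: (D_central Hring Hsp reg2 reg3 regM regN regS regB Dadd HD').
Qed.
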